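(* Let $M$ be a PML model with goal expression $e$, let $\mathcal{M}=(\mathrm{STATE},\mathrm{Init}[M],\mathrm{Step}\llbracket M\rrbracket,\mathcal{G})$ be the Markov chain it denotes, where $\mathcal{G}=\{s\in\mathrm{STATE}:\llbracket e\rrbracket s\neq0\}$, and let $\Xi$ be the map sending distributions on $\mathrm{STATE}$ to tensors. Then for every $n\in\mathbb{N}$, $$\Pr_M\bigl(\Xi(\mathrm{Init}[M])\rhd\Diamond^{\le n}e\bigr)=\Pr_{\mathcal{M}}\bigl(\Diamond^{\le n}\mathcal{G}\bigr),$$ where the left side is the tensor-based and the right side the standard step-bounded reachability probability.
   Context: **Models.** A PML model $M$ consists of modules $m_1,\dots,m_K$ and a goal expression $e$. Module $m_k$ declares a finite set $X_k$ of state variables (the $X_k$ are pairwise disjoint); each variable $x$ has a domain $\mathrm{dom}(x)=\{0,\dots,n_{\max}(x)\}\subset\mathbb{N}$ and an initial value in $\mathrm{dom}(x)$. $m_k$ also has a finite set of commands of the form $[a]\;g\to U$, with action label $a$, guard expression $g$, and mixture of updates $U=\theta_1:u_1+\cdots+\theta_n:u_n$ with $\theta_i\in[0,1]$, $\sum_i\theta_i=1$. An update $u$ is a list of assignments $x_1:=e_1\cdots x_n:=e_n$ to distinct variables of $X_k$. Expressions are constants $n\in\mathbb{N}$, variables, or $op(e_1,\dots,e_l)$, where $op$ denotes a function $\llbracket op\rrbracket:\mathbb{N}^l\to\mathbb{N}$; they may read variables of all modules. $\mathrm{Vars}(M)=\biguplus_kX_k$. $Y_k$ is the set of variables that are declared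 in $m_k$ or read in commands of $m_k$, so $X_k\subseteq Y_k\subseteq\mathrm{Vars}(M)$. $\mathrm{Act}(m_k)$ is the set of action labels in commands of $m_k$, $\mathrm{Act}(M)=\bigcup_k\mathrm{Act}(m_k)$, and $C(m_k,a)$ is the set of commands of $m_k$ labelled $a$. For a set of variables $X$, $\mathrm{STATE}(X)$ is the (finite) set of maps $s$ with $s(x)\in\mathrm{dom}(x)$ for $x\in X$; $\mathrm{STATE}=\mathrm{STATE}(\mathrm{Vars}(M))$; $s|_X$ is restriction. $\mathbb{1}[P]$ is $1$ if $P$ holds, else $0$; $\delta_s$ is the point mass at $s$. **Standard semantics.** $\llbracket n\rrbracket s=n$, $\llbracket x\rrbracket s=s(x)$, $\llbracket op(e_1,\dots,e_l)\rrbracket s=\llbracket op\rrbracket(\llbracket e_1\rrbracket s,\dots,\llbracket e_l\rrbracket s)$. For an update $u$ in $m_k$ and $s\in\mathrm{STATE}(Y_k)$, $\llbracket u\rrbracket s\in\mathrm{STATE}(X_k)$ is $s|_{X_k}$ with $x_i$ reassigned to $\llbracket e_i\rrbracket s$ for each $i$ (updates are assumed to produce values in the domains). $\llbracket U\rrbracket s=\sum_i\theta_i\,\delta_{\llbracket u_i\rrbracket s}$, a distribution on $\mathrm{STATE}(X_k)$. For $a\in\mathrm{Act}(M)$, $s\in\mathrm{STATE}(Y_k)$: if $a\notin\mathrm{Act}(m_k)$, then $\llbracket m_k\rrbracket a\,s=\delta_{s|_{X_k}}$ and $\mathrm{En}\llbracket m_k\rrbracket a\,s=1$; otherwise $\llbracket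 m_k\rrbracket a\,s=\sum_{[a]g\to U\in C(m_k,a)}\mathbb{1}[\llbracket g\rrbracket s\ne0]\cdot\llbracket U\rrbracket s$ (an unnormalized distribution on $\mathrm{STATE}(X_k)$) and $\mathrm{En}\llbracket m_k\rrbracket a\,s=\sum_{[a]g\to U\in C(m_k,a)}\mathbb{1}[\llbracket g\rrbracket s\neq0]$. For $s\in\mathrm{STATE}$, $\mathrm{En}\llbracket M\rrbracket a\,s=\prod_{k}\mathrm{En}\llbracket m_k\rrbracket a\,(s|_{Y_k})$. Finally, for $s\in\mathrm{STATE}$, $$\mathrm{Step}\llbracket M\rrbracket s=\frac{\sum_{a\in\mathrm{Act}(M)}\bigotimes_{k=1}^K\llbracket m_k\rrbracket a\,(s|_{Y_k})}{\sum_{a\in\mathrm{Act}(M)}\mathrm{En}\llbracket M\rrbracket a\,s}\ \text{ if the denominator is }>0,\qquad \mathrm{Step}\llbracket M\rrbracket s=\delta_s\ \text{ otherwise},$$ where $\bigl(\bigotimes_k\nu_k\bigr)(s')=\prod_k\nu_k(s'|_{X_k})$. $\mathrm{Init}[M]=\delta_{s_0}$ with $s_0$ the state giving each variable its initial value. **Standard reachability.** For $\mathcal{M}$ with transition function $\eta=\mathrm{Step}\llbracket M\rrbracket$, write $\eta(s,s')=\eta(s)(s')$. $\Pr_{\mathcal{M}}(s\vDash\Diamond^{\le0}\mathcal{G})=\mathbb{1}[s\in\mathcal{G}]$; $\Pr_{\mathcal{M}}(s\vDash\Diamond^{\le n+1}\mathcal{G})=1$ if $s\in\mathcal{G}$ and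 $\sum_{s'}\eta(s,s')\Pr_{\mathcal{M}}(s'\vDash\Diamond^{\le n}\mathcal{G})$ otherwise; $\Pr_{\mathcal{M}}(\Diamond^{\le n}\mathcal{G})=\sum_s\mathrm{Init}[M](s)\Pr_{\mathcal{M}}(s\vDash\Diamond^{\le n}\mathcal{G})$. **Tensors.** A tensor over $\mathrm{STATE}(X)$ is a real- (or natural-) valued array $T$ with entries $T[s]$, $s\in\mathrm{STATE}(X)$; tensors over $\mathrm{STATE}(Y_k\uplus X_k)$ (tagged disjoint union) are indexed by pairs $(s,s')\in\mathrm{STATE}(Y_k)\times\mathrm{STATE}(X_k)$. $\mathbf{1}_X,\mathbf{0}_X$ are the all-ones and all-zeros tensors; $I_{x\in X}$ is the index tensor $I_{x\in X}[s]=s(x)$; $\odot$ is the entrywise product, $\otimes$ the outer product $(A\otimes B)[(s,s')]=A[s]B[s']$; comparisons, $\mathbb{1}[\cdot]$, division and $\max$ are entrywise. For an unnormalized distribution $\mu$ on $\mathrm{STATE}$, $\Xi(\mu)$ is the tensor with $\Xi(\mu)[s]=\mu(s)$. **Tensor semantics.** $\langle\!\langle n\rangle\!\rangle_X=n\cdot\mathbf{1}_X$, $\langle\!\langle x\rangle\!\rangle_X=I_{x\in X}$, $\langle\!\langle op(e_1,\dots,e_l)\rangle\!\rangle_X$ is $\llbracket op\rrbracket$ applied entrywise to $\langle\!\langle e_1\rangle\!\rangle_X,\dots,\langle\!\langle e_l\rangle\!\rangle_X$. For $u=(x_1:=e_1\cdots x_n:=e_n)$ in $m_k$ and $x\in X_k$: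 $\langle\!\langle u\rangle\!\rangle_{Y_k}x=\langle\!\langle e_i\rangle\!\rangle_{Y_k}$ if $x=x_i$ for some $i$, else $I_{x\in Y_k}$. For mixtures, $$\langle\!\langle U\rangle\!\rangle=\sum_i\theta_i\cdot\bigodot_{x\in X_k}\mathbb{1}\bigl[(\langle\!\langle u_i\rangle\!\rangle_{Y_k}x)\otimes\mathbf{1}_{X_k}=\mathbf{1}_{Y_k}\otimes I_{x\in X_k}\bigr].$$ For modules: if $a\notin\mathrm{Act}(m_k)$, $\langle\!\langle m_k\rangle\!\rangle a=\bigodot_{x\in X_k}\mathbb{1}[I_{x\in Y_k}\otimes\mathbf{1}_{X_k}=\mathbf{1}_{Y_k}\otimes I_{x\in X_k}]$ and $\mathrm{En}\langle\!\langle m_k\rangle\!\rangle a=\mathbf{1}_{Y_k}$; otherwise $\langle\!\langle m_k\rangle\!\rangle a=\sum_{[a]g\to U\in C(m_k,a)}(\mathbb{1}[\langle\!\langle g\rangle\!\rangle_{Y_k}\ne0]\otimes\mathbf{1}_{X_k})\odot\langle\!\langle U\rangle\!\rangle$ and $\mathrm{En}\langle\!\langle m_k\rangle\!\rangle a=\sum_{[a]g\to U\in C(m_k,a)}\mathbb{1}[\langle\!\langle g\rangle\!\rangle_{Y_k}\neq0]$. Put $\mathrm{En}\langle\!\langle M\rangle\!\rangle a[s]=\prod_k\mathrm{En}\langle\!\langle m_k\rangle\!\rangle a[s|_{Y_k}]$ and $L=\sum_a\mathrm{En}\langle\!\langle M\rangle\!\rangle a$. The model denotes the tensor transformer $$\langle\!\langle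 M\rangle\!\rangle T=\Bigl(\sum_{a}P_a\Bigr)+T\odot\mathbb{1}[L=\mathbf{0}_{\mathrm{Vars}(M)}],\quad P_a[s']=\sum_{s\in\mathrm{STATE}}\Bigl(\tfrac{T}{\max(L,\mathbf{1}_{\mathrm{Vars}(M)})}\Bigr)[s]\cdot\prod_{k=1}^K(\langle\!\langle m_k\rangle\!\rangle a)[(s|_{Y_k},s'|_{X_k})].$$ **Tensor reachability.** Let $\Delta_e=\mathbb{1}[\langle\!\langle e\rangle\!\rangle_{\mathrm{Vars}(M)}\ne\mathbf{0}]$, $\Delta_{\neg e}=\mathbb{1}[\langle\!\langle e\rangle\!\rangle_{\mathrm{Vars}(M)}=\mathbf{0}]$, $\langle A,B\rangle=\sum_sA[s]B[s]$. For a tensor $T$ over $\mathrm{STATE}$: $\Pr_M(T\rhd\Diamond^{\le0}e)=\langle\Delta_e,T\rangle$ and $\Pr_M(T\rhd\Diamond^{\le n+1}e)=\langle\Delta_e,T\rangle+\Pr_M\bigl(\langle\!\langle M\rangle\!\rangle(\Delta_{\neg e}\odot T)\rhd\Diamond^{\le n}e\bigr)$. *)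

(* Defs.v *)
From Stdlib Require List.
From mathcomp Require Import all_boot all_order all_algebra reals.

Set Implicit Arguments.
Unset Strict Implicit.
Unset Printing Implicit Defensive.

Import Order.TTheory GRing.Theory Num.Theory.
Local Open Scope ring_scope.

(* [nat ^ l] is [{ffun 'I_l -> nat}], so [interp o] is a function from N^l
   to N, with l = arity o. *)
Record signature := Signature {
  op : Type;
  arity : op -> nat;
  interp : forall o : op, (nat ^ arity o)%type -> nat }.

Inductive expr (Sg : signature) (V : Type) : Type :=
| Const of nat
| Var of V
| Op (o : op Sg) of (expr Sg V ^ arity o)%type.

Arguments Const {Sg V}.
Arguments Var {Sg V}.
Arguments Op {Sg V}.

Fixpoint vars (Sg : signature) (V : finType) (e : expr Sg V) : {set V} :=
  match e with
  | Const _ => set0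
  | Var x => [set x]
  | Op o es => \bigcup_(i < arity o) vars (es i)
  end.

Section States.
Variables (V : finType) (nmax : V -> nat).

Definition STATE (X : {set V}) : finType :=
  {dffun forall x : {x : V | x \in X}, 'I_(nmax (val x)).+1}.

(* s(x); 0 is a dummy for x outside X: in a model, an expression is only
   evaluated on states that contain its variables. *)
Definition get (X : {set V}) (s : STATE X) (x : V) : nat :=
  if insub x is Some x' then nat_of_ord (s x') else 0%N.

Definition restr (X Z : {set V}) (sXZ : X \subset Z) (s : STATE Z) : STATE X :=
  [ffun x : {x : V | x \in X} => s (Sub (val x) (subsetP sXZ _ (valP x)))].

Fixpoint eval (Sg : signature) (X : {set V}) (e : expr Sg V) (s : STATE X) :
    nat :=
  match e with
  | Const n => n
  | Var x => get s x
  | Op o es => interp [ffun i : 'I_(arity o) => eval (es i) s]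
  end.

End States.

Section Models.
Variables (R : realType) (Sg : signature) (V A : finType) (nmax : V -> nat).

(* x_1 := e_1 ... x_n := e_n *)
Definition update := seq (V * expr Sg V).

(* theta_1 : u_1 + ... + theta_n : u_n *)
Definition mixture := seq (R * update).

Definition assigned (u : update) (x : V) : option (expr Sg V) :=
  ohead [seq p.2 | p <- u & p.1 == x].

(* [label] guard -> mix *)
Record command := Command {
  label : A;
  guard : expr Sg V;
  mix : mixture }.

Definition update_reads (u : update) : {set V} := \bigcup_(p <- u) vars p.2.

Definition command_reads (c : command) : {set V} :=
  vars (guard c) :|: \bigcup_(p <- mix c) update_reads p.2.

Definition reads (X : {set V}) (C : seq command) : {set V} :=
  X :|: \bigcup_(c <- C) command_reads c.

Definition distribution_weights (U : mixture) : bool :=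
  all (fun p => 0 <= p.1 <= 1) U && (\sum_(p <- U) p.1 == 1).

Definition wf_assignments (X : {set V}) (u : update) : bool :=
  uniq [seq p.1 | p <- u] && all (fun p => p.1 \in X) u.

Definition in_domains (Y : {set V}) (u : update) : bool :=
  [forall s : STATE nmax Y, all (fun p => (eval p.2 s <= nmax p.1)%N) u].

(* [NoDup]: the commands form a set. *)
Record pml_module := PMLModule {
  decl : {set V};
  commands : seq command;
  commands_set : List.NoDup commands;
  weightsP : all (fun c => distribution_weights (mix c)) commands;
  assignmentsP :
    all (fun c => all (fun p => wf_assignments decl p.2) (mix c)) commands;
  domainsP :
    all (fun c => all (fun p => in_domains (reads decl commands) p.2) (mix c))
      commands }.

Definition scope (m : pml_module) : {set V} := reads (decl m) (commands m).

Definition mod_act (m : pml_module) : {set A} :=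
  [set a in [seq label c | c <- commands m]].

(* V only provides names: the variables of the model are those declared in
   its modules, and [init x] is relevant only for these. *)
Record model := Model {
  K : nat;
  mods : 'I_K -> pml_module;
  init : forall x : V, 'I_(nmax x).+1;
  goal : expr Sg V;
  decl_disjoint :
    forall j k, j != k -> [disjoint decl (mods j) & decl (mods k)];
  scope_declared : forall k, scope (mods k) \subset \bigcup_j decl (mods j);
  goal_declared : vars goal \subset \bigcup_j decl (mods j) }.

Definition Vars (M : model) : {set V} := \bigcup_k decl (mods (m := M) k).

Definition Act (M : model) : {set A} := \bigcup_k mod_act (mods (m := M) k).

Lemma decl_scope (m : pml_module) : decl m \subset scope m.
Proof. exact: subsetUl. Qed.

Lemma decl_Vars (M : model) (k : 'I_(K M)) : decl (mods k) \subset Vars M.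
Proof. exact: bigcup_sup. Qed.

Lemma scope_Vars (M : model) (k : 'I_(K M)) : scope (mods k) \subset Vars M.
Proof. exact: scope_declared. Qed.

Definition dirac (S : finType) (s : S) : S -> R := fun s' => (s' == s)%:R.

(* Updates of a module stay within the domains, so the default value of
   [inord] is never taken. *)
Definition update_sem (m : pml_module) (u : update)
    (s : STATE nmax (scope m)) : STATE nmax (decl m) :=
  [ffun x : {x : V | x \in decl m} =>
     inord (if assigned u (val x) is Some e then eval e s
            else get s (val x))].

Definition mixture_sem (m : pml_module) (U : mixture)
    (s : STATE nmax (scope m)) : STATE nmax (decl m) -> R :=
  fun s' => \sum_(p <- U) p.1 * dirac (update_sem p.2 s) s'.

Definition module_sem (m : pml_module) (a : A) (s : STATE nmax (scope m)) :
    STATE nmax (decl m) -> R :=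
  if a \in mod_act m then
    fun s' => \sum_(c <- commands m | label c == a)
                (eval (guard c) s != 0%N)%:R * mixture_sem (mix c) s s'
  else dirac (restr (decl_scope m) s).

Definition module_En (m : pml_module) (a : A) (s : STATE nmax (scope m)) : R :=
  if a \in mod_act m then
    \sum_(c <- commands m | label c == a) (eval (guard c) s != 0%N)%:R
  else 1.

Section StandardModel.
Variable M : model.

Definition model_state : finType := STATE nmax (Vars M).

Definition model_En (a : A) (s : model_state) : R :=
  \prod_(k < K M) module_En a (restr (scope_Vars k) s).

Definition Step (s s' : model_state) : R :=
  let d := \sum_(a in Act M) model_En a s in
  if 0 < d then
    (\sum_(a in Act M)
       \prod_(k < K M) module_sem a (restr (scope_Vars k) s)
                                    (restr (decl_Vars k) s')) / d
  else dirac s s'.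

Definition init_state : model_state :=
  [ffun x : {x : V | x \in Vars M} => init M (val x)].

Definition Init : model_state -> R := dirac init_state.

Definition goal_states : {set model_state} :=
  [set s : model_state | eval (goal M) s != 0%N].

End StandardModel.

End Models.

Arguments Step {R Sg V A nmax} M s s'.
Arguments Init {R Sg V A nmax} M s.
Arguments goal_states {R Sg V A nmax} M.

(* Only the data: for the chain of a model, that [Init] and [Step] are
   probability distributions follows from well-formedness of the model. *)
Record markov_chain (R : realType) := MarkovChain {
  mc_state : finType;
  mc_init : mc_state -> R;
  mc_trans : mc_state -> mc_state -> R;
  mc_goal : {set mc_state} }.

Arguments mc_init {R} C s : rename.
Arguments mc_trans {R} C s s' : rename.

Definition chain_of (R : realType) (Sg : signature) (V A : finType)
    (nmax : V -> nat) (M : model R Sg A nmax) : markov_chain R :=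
  MarkovChain (Init M) (Step M) (goal_states M).

Fixpoint reach_from (R : realType) (C : markov_chain R) (n : nat)
    (s : mc_state C) : R :=
  match n with
  | 0%N => (s \in mc_goal C)%:R
  | n'.+1 => if s \in mc_goal C then 1
             else \sum_s' mc_trans C s s' * reach_from n' s'
  end.

Definition reach (R : realType) (C : markov_chain R) (n : nat) : R :=
  \sum_s mc_init C s * reach_from n s.

(* A tensor over STATE(X) is a [{ffun STATE nmax X -> S}] with S = nat or R.
   MathComp's semiring structure on such functions is pointwise: 1 is the
   all-ones tensor, * the entrywise product, \sum and \prod are entrywise. *)

Section Tensors.
Variable R : realType.

Definition outer (S : pzSemiRingType) (I J : finType)
    (T1 : {ffun I -> S}) (T2 : {ffun J -> S}) : {ffun I * J -> S} :=
  [ffun p : I * J => T1 p.1 * T2 p.2].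

Definition tscale (I : finType) (c : R) (T : {ffun I -> R}) : {ffun I -> R} :=
  [ffun i => c * T i].

Definition tdiv (I : finType) (T1 T2 : {ffun I -> R}) : {ffun I -> R} :=
  [ffun i => T1 i / T2 i].

Definition tmax (I : finType) (T1 T2 : {ffun I -> R}) : {ffun I -> R} :=
  [ffun i => Num.max (T1 i) (T2 i)].

Definition ind_eq (S : eqType) (I : finType) (T1 T2 : {ffun I -> S}) :
    {ffun I -> R} := [ffun i => (T1 i == T2 i)%:R].

Definition ind_neq (S : eqType) (I : finType) (T1 T2 : {ffun I -> S}) :
    {ffun I -> R} := [ffun i => (T1 i != T2 i)%:R].

Definition inner (I : finType) (T1 T2 : {ffun I -> R}) : R :=
  \sum_i T1 i * T2 i.

Definition Xi (I : finType) (mu : I -> R) : {ffun I -> R} := [ffun i => mu i].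

End Tensors.

Section TensorSemantics.
Variables (R : realType) (Sg : signature) (V A : finType) (nmax : V -> nat).

Definition index_tensor (X : {set V}) (x : V) : {ffun STATE nmax X -> nat} :=
  [ffun s => get s x].

Fixpoint texpr (X : {set V}) (e : expr Sg V) : {ffun STATE nmax X -> nat} :=
  match e with
  | Const n => [ffun=> n]
  | Var x => index_tensor X x
  | Op o es =>
      [ffun s => interp [ffun i : 'I_(arity o) => texpr X (es i) s]]
  end.

Section TensorModule.
Variable m : pml_module R Sg A nmax.

Definition scope_state : finType := STATE nmax (scope m).
Definition decl_state : finType := STATE nmax (decl m).

Definition tupdate (u : update Sg V) (x : V) : {ffun scope_state -> nat} :=
  if assigned u x is Some e then texpr (scope m) e
  else index_tensor (scope m) x.

Definition tmixture (U : mixture R Sg V) : {ffun scope_state * decl_state -> R} :=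
  \sum_(p <- U) tscale p.1
    (\prod_(x in decl m)
       ind_eq R (outer (tupdate p.2 x) (1 : {ffun decl_state -> nat}))
                (outer (1 : {ffun scope_state -> nat}) (index_tensor (decl m) x))).

Definition tmodule (a : A) : {ffun scope_state * decl_state -> R} :=
  if a \in mod_act m then
    \sum_(c <- commands m | label c == a)
      outer (ind_neq R (texpr (scope m) (guard c)) 0)
            (1 : {ffun decl_state -> R})
      * tmixture (mix c)
  else
    \prod_(x in decl m)
      ind_eq R (outer (index_tensor (scope m) x) (1 : {ffun decl_state -> nat}))
               (outer (1 : {ffun scope_state -> nat}) (index_tensor (decl m) x)).

Definition tmodule_En (a : A) : {ffun scope_state -> R} :=
  if a \in mod_act m then
    \sum_(c <- commands m | label c == a)
      ind_neq R (texpr (scope m) (guard c)) 0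
  else 1.

End TensorModule.

Section TensorModel.
Variable M : model R Sg A nmax.

Definition tmodel_En (a : A) : {ffun model_state M -> R} :=
  [ffun s => \prod_(k < K M) tmodule_En (mods k) a (restr (scope_Vars k) s)].

Definition tL : {ffun model_state M -> R} := \sum_(a in Act M) tmodel_En a.

Definition tP (T : {ffun model_state M -> R}) (a : A) :
    {ffun model_state M -> R} :=
  [ffun s' => \sum_(s : model_state M)
     tdiv T (tmax tL 1) s *
     \prod_(k < K M) tmodule (mods k) a
        (restr (scope_Vars k) s, restr (decl_Vars k) s')].

Definition tmodel (T : {ffun model_state M -> R}) :
    {ffun model_state M -> R} :=
  (\sum_(a in Act M) tP T a) + T * ind_eq R tL 0.

Definition Delta (e : expr Sg V) : {ffun model_state M -> R} :=
  ind_neq R (texpr (Vars M) e) 0.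

Definition Delta_not (e : expr Sg V) : {ffun model_state M -> R} :=
  ind_eq R (texpr (Vars M) e) 0.

Fixpoint treach (e : expr Sg V) (n : nat) (T : {ffun model_state M -> R}) : R :=
  match n with
  | 0%N => inner (Delta e) T
  | n'.+1 => inner (Delta e) T + treach e n' (tmodel (Delta_not e * T))
  end.

End TensorModel.

End TensorSemantics.

(* Main.v *)
(* Each tensor entry is the corresponding standard value, and [L] is
   natural-valued, so [max (L, 1)] is [L] on live states and [1] on deadlocked
   ones, where the product terms vanish.  Hence the transformer of the model is
   [T s' |-> \sum_s T s * Step s s'].  The two recursions are dual: by induction
   on [n], tensor reachability from any [T] is the pairing of [T] with the
   function [s |-> Pr (s |= <>^{<= n} G)]. *)
Require Import Defs.
From mathcomp Require Import all_boot all_order all_algebra reals.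

Set Implicit Arguments.
Unset Strict Implicit.
Unset Printing Implicit Defensive.

Import Order.TTheory GRing.Theory Num.Theory.
Local Open Scope ring_scope.

(** Commands and updates have no decidable equality, so the side condition on the entries comes
    through [all] instead of membership. *)
Lemma eq_big_all (S : nmodType) (T : Type) (a P : pred T) (r : seq T)
    (F G : T -> S) :
  all a r -> (forall x, a x -> P x -> F x = G x) ->
  \sum_(x <- r | P x) F x = \sum_(x <- r | P x) G x.
Proof.
move=> ar FG; elim: r ar => [|x r IH] /=; first by rewrite !big_nil.
by case/andP=> ax ar; rewrite !big_cons IH //; case: ifP => // /(FG x ax) ->.
Qed.

Lemma prod_ffunE (S : comPzSemiRingType) (I : finType) (T : Type) (r : seq T)
    (P : pred T) (F : T -> {ffun I -> S}) (i : I) :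
  (\prod_(x <- r | P x) F x) i = \prod_(x <- r | P x) F x i.
Proof.
by apply: (big_morph (fun f : {ffun I -> S} => f i)) => [f g|]; rewrite ffunE.
Qed.

Lemma prod_indicator (R : comPzSemiRingType) (T : finType) (P b : pred T) :
  \prod_(x | P x) (b x)%:R = [forall (x | P x), b x]%:R :> R.
Proof.
case: forallP => [h|/forallP].
  by rewrite big1 // => x Px; rewrite (implyP (h x) Px).
rewrite negb_forall => /existsP[x]; rewrite negb_imply => /andP[Px /negPf bx].
by rewrite (bigD1 x) //= bx mul0r.
Qed.

Section States.
Variables (V : finType) (nmax : V -> nat).
Implicit Types X Z : {set V}.

Lemma getE X (s : STATE nmax X) (x : {x : V | x \in X}) : get s (val x) = s x.
Proof. by rewrite /get valK. Qed.

Lemma get_le X (s : STATE nmax X) (x : V) : (get s x <= nmax x)%N.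
Proof.
rewrite /get; case: insubP => // x' _ <-.
by rewrite -ltnS ltn_ord.
Qed.

Lemma get_restr X Z (sXZ : X \subset Z) (s : STATE nmax Z) (x : V) :
  x \in X -> get (restr sXZ s) x = get s x.
Proof.
move=> xX; rewrite /get !insubT ?(subsetP sXZ) // => xZ; rewrite ffunE /=.
(* [restr] and [insubT] carry different proofs of [x \in Z]. *)
by rewrite (bool_irrelevance (subsetP _ _ _) xZ).
Qed.

(** The sides of the inner equality are swapped to match the factors in [prod_ind_eq]. *)
Lemma eq_state X (s s' : STATE nmax X) :
  (s == s') = [forall (x | x \in X), get s' x == get s x].
Proof.
apply/eqP/forall_inP => [-> //|h].
apply/ffunP => x; apply: ord_inj; rewrite -!getE.
by apply/esym/eqP/h; exact: valP.
Qed.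

Lemma texprE (Sg : signature) X (e : expr Sg V) (s : STATE nmax X) :
  texpr nmax X e s = eval e s.
Proof.
(* The arguments of [Op] sit inside a finite function; the explicit fixpoint gives [IH] at each
   [es i]. *)
move: e; fix IH 1 => -[n|x|o es] /=; rewrite ffunE //.
by congr interp; apply/ffunP => i; rewrite !ffunE IH.
Qed.

End States.

Section Module.
Variables (R : realType) (Sg : signature) (V A : finType) (nmax : V -> nat).
Variable m : pml_module R Sg A nmax.
Implicit Types (s : STATE nmax (scope m)) (t : STATE nmax (decl m)).

Lemma assigned_all (P : pred (V * expr Sg V)) (u : update Sg V) x e :
  all P u -> assigned u x = Some e -> P (x, e).
Proof.
elim: u => [|[y f] u IH] //= /andP[Pyf Pu]; rewrite /assigned /=.
by case: eqP => [<- [<-]|_] //; exact: IH.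
Qed.

(** [inord] never takes its default: an assigned value is bounded by [in_domains], an unassigned one
    by [get_le]. *)
Lemma get_update_sem u s x : in_domains nmax (scope m) u -> x \in decl m ->
  get (update_sem u s) x = tupdate m u x s.
Proof.
move=> /forallP/(_ s) dom xX.
rewrite -[x in LHS]/(val (Sub x xX : {x : V | x \in decl m})) getE ffunE /=.
rewrite /tupdate; case E: (assigned u x) => [e|]; last first.
  by rewrite ffunE inordK // ltnS get_le.
by rewrite texprE inordK // ltnS (assigned_all dom E).
Qed.

(** A product of 0/1 factors tests agreement on all declared variables at once. [f] gives the
    updated values for a mixture, and the old values for a module without the action. *)
Lemma prod_ind_eq (f : V -> {ffun STATE nmax (scope m) -> nat}) s t t0 :
  (forall x, x \in decl m -> get t0 x = f x s) ->
  (\prod_(x in decl m)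
     ind_eq R (outer (f x) (1 : {ffun STATE nmax (decl m) -> nat}))
              (outer (1 : {ffun STATE nmax (scope m) -> nat})
                     (index_tensor nmax (decl m) x))) (s, t)
  = dirac R t0 t.
Proof.
move=> t0E; rewrite prod_ffunE /dirac eq_state -prod_indicator.
by apply: eq_bigr => x xX; rewrite !ffunE /= mulr1 mul1r t0E.
Qed.

Lemma tmixtureE U s t : all (fun p => in_domains nmax (scope m) p.2) U ->
  tmixture m U (s, t) = mixture_sem U s t.
Proof.
move=> dom; rewrite /tmixture sum_ffunE.
apply: (eq_big_all dom) => p dp _; rewrite ffunE; congr (_ * _).
by apply: prod_ind_eq => x; exact: get_update_sem.
Qed.

Lemma tmoduleE a s t : tmodule m a (s, t) = module_sem a s t.
Proof.
rewrite /tmodule /module_sem; case: ifP => _.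
  rewrite sum_ffunE; apply: (eq_big_all (domainsP m)) => c dc _.
  by rewrite !ffunE /= texprE mulr1 tmixtureE.
by apply: prod_ind_eq => x xX; rewrite get_restr // ffunE.
Qed.

Lemma tmodule_EnE a s : tmodule_En m a s = module_En a s.
Proof.
rewrite /tmodule_En /module_En; case: ifP => _; last by rewrite ffunE.
by rewrite sum_ffunE; apply: eq_bigr => c _; rewrite !ffunE texprE.
Qed.

Lemma module_En_nat a s : module_En a s \is a Num.nat.
Proof.
rewrite /module_En; case: ifP => _ //.
by apply: rpred_sum => c _; exact: natr_nat.
Qed.

(** [module_En] counts true guards, so if it is 0 each guard indicator in [module_sem] is 0. Without
    the action it is 1, contradicting the hypothesis. *)
Lemma module_sem_eq0 a s t : module_En a s = 0 -> module_sem a s t = 0.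
Proof.
rewrite /module_En /module_sem; case: ifP => _; last first.
  by move/eqP; rewrite oner_eq0.
elim: (commands m) => [|c C IH]; rewrite ?big_nil // !big_cons.
case: ifP => // _ /eqP; rewrite paddr_eq0 ?ler0n ?sumr_ge0 //.
by case/andP=> /eqP -> /eqP /IH ->; rewrite mul0r addr0.
Qed.

End Module.

Section Model.
Variables (R : realType) (Sg : signature) (V A : finType) (nmax : V -> nat).
Variable M : model R Sg A nmax.
Implicit Types (s : model_state M) (T : {ffun model_state M -> R}).

Lemma tLE s : tL M s = \sum_(a in Act M) model_En a s.
Proof.
rewrite sum_ffunE; apply: eq_bigr => a _; rewrite ffunE.
by apply: eq_bigr => k _; exact: tmodule_EnE.
Qed.

Lemma model_En_nat a s : model_En a s \is a Num.nat.
Proof. by apply: rpred_prod => k _; exact: module_En_nat. Qed.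

Lemma tL_nat s : tL M s \is a Num.nat.
Proof. by rewrite tLE; apply: rpred_sum => a _; exact: model_En_nat. Qed.

(** Needed at deadlocked states, where [tmodel] still adds these products but [Step] discards
    them. *)
Lemma module_sem_prod_eq0 a s s' : model_En a s = 0 ->
  \prod_(k < K M) module_sem a (restr (scope_Vars k) s)
                               (restr (decl_Vars k) s') = 0.
Proof.
move=> /eqP/prodf_eq0[k _ /eqP Enk0].
by rewrite (bigD1 k) //= module_sem_eq0 // mul0r.
Qed.

Lemma tmodelE T s' : tmodel T s' = \sum_s T s * Step M s s'.
Proof.
(* The deadlock term is also written as a sum over [s], supported at [s = s'], so that the claim can
   be checked for each [s]. *)
have -> : tmodel T s' = \sum_s (T s / Num.max (tL M s) 1 *
    (\sum_(a in Act M) \prod_(k < K M)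
       module_sem a (restr (scope_Vars k) s) (restr (decl_Vars k) s')) +
    T s * ((s' == s) && (tL M s == 0))%:R).
  rewrite /tmodel ffunE big_split /=; congr (_ + _).
    rewrite sum_ffunE; under [LHS]eq_bigr do rewrite ffunE.
    rewrite exchange_big; apply: eq_bigr => s _; rewrite mulr_sumr.
    apply: eq_bigr => a _; rewrite !ffunE; congr (_ * _).
    by apply: eq_bigr => k _; exact: tmoduleE.
  rewrite (bigD1 s') //= eqxx big1 ?addr0 ?ffunE ?ffunE //.
  by move=> s /negPf; rewrite eq_sym => ->; rewrite mulr0.
apply: eq_bigr => s _; rewrite /Step -tLE.
have /natrP[l lE] := tL_nat s; rewrite lE ltr0n pnatr_eq0.
(* If [L] is a successor, it is at least 1: the maximum is [L] and the deadlock term vanishes. *)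
case: l lE => [|l] lE /=; last first.
  rewrite andbF mulr0 addr0 (max_idPl _) ?ler1n //.
  by rewrite mulrAC mulrA.
rewrite andbT big1 ?mulr0 ?add0r // => a aM; apply: module_sem_prod_eq0.
(* A vanishing sum of nonnegative terms forces each [model_En a s] to be 0. *)
move: lE; rewrite tLE => /eqP; rewrite psumr_eq0; last first.
  by move=> b _; rewrite natr_ge0 ?model_En_nat.
by move=> /allP/(_ a (mem_index_enum a)); rewrite aM => /eqP.
Qed.

Lemma treach_pairing n T :
  treach (goal M) n T = \sum_s T s * reach_from n (s : mc_state (chain_of M)).
Proof.
have DeltaE s : Delta M (goal M) s = (s \in goal_states M)%:R.
  by rewrite !ffunE texprE inE.
have Delta_notE s : Delta_not M (goal M) s = (s \notin goal_states M)%:R.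
  by rewrite !ffunE texprE inE negbK.
elim: n T => [|n IH] T /=; rewrite /inner.
  by apply: eq_bigr => s _; rewrite DeltaE mulrC.
rewrite IH; under [X in _ + X]eq_bigr do rewrite tmodelE mulr_suml.
(* Exchanging the sums moves the transition step from the tensor to the reachability function. *)
rewrite exchange_big -big_split /=; apply: eq_bigr => s _.
rewrite DeltaE; under eq_bigr do rewrite ffunE Delta_notE.
(* In a goal state the mask removes the recursive term and [T s] remains; elsewhere only the
   recursive term survives. *)
case: (s \in _) => /=.
  by rewrite mulrC big1 ?addr0 // => t _; rewrite !mul0r.
by rewrite mul0r add0r mulr_sumr; apply: eq_bigr => t _; rewrite mul1r mulrA.
Qed.

End Model.

Theorem theorem5 (R : realType) (Sg : signature) (V A : finType)
    (nmax : V -> nat) (M : model R Sg A nmax) (n : nat) :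
  treach (goal M) n (Xi (Init M)) = reach (chain_of M) n.
Proof.
by rewrite treach_pairing; apply: eq_bigr => s _; rewrite ffunE.
Qed.
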